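(* Let $\mathcal{K}$ be any finite dimensional complex Hilbert space and let $\mathcal{H}$ be a complex Hilbert space with $\dim\mathcal{H}=2$. Then any locally completely positive map which is extremal in the cone of positive maps between $\mathfrak{B}(\mathcal{K})$ and $\mathfrak{B}(\mathcal{H})$ is completely positive.
   Context: $\mathfrak{B}(\mathcal{K})$ denotes the bounded operators on $\mathcal{K}$. A linear map $\phi:\mathfrak{B}(\mathcal{K})\to\mathfrak{B}(\mathcal{H})$ is positive if it maps positive operators to positive operators; the cone of positive maps is ordered by $\psi\leq\phi$ iff $\phi-\psi$ is positive. An element $\phi$ of this cone is extremal if $\{\lambda\phi:\lambda\geq0\}$ is a face, i.e. $0\leq\psi\leq\lambda\phi$ with $\lambda\ge0$ implies that $\psi$ is a non-negative multiple of $\phi$. A positive map $\phi$ is locally completely positive if there is a constant $\gamma>0$ such that $(\gamma\phi)(X^*X)\geq(\gamma\phi)(X^* )(\gamma\phi)(X)$ for all $X\in\mathfrak{B}(\mathcal{K})$. $\phi$ is completely positive if for every $k\in\mathbb{N}$ the map $[A_{ij}]\mapsto[\phi(A_{ij})]$ from $M_k(\mathfrak{B}(\mathcal{K}))$ to $M_k(\mathfrak{B}(\mathcal{H}))$ is positive. *)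

(* Defs.v *)
From HB Require Import structures.
From mathcomp Require Import all_boot all_order all_algebra.
From mathcomp Require Import sesquilinear.

Set Implicit Arguments.
Unset Strict Implicit.
Unset Printing Implicit Defensive.

Import Order.TTheory GRing.Theory Num.Theory.
Local Open Scope ring_scope.

(* With C := R[i] for R : realType, a finite dimensional complex Hilbert space
   is a [vectType C] together with an inner product, linear in its first
   argument.  All linear operators on it are bounded, so 'End(K) is B(K), and
   'Hom('End(K), 'End(H)) is the vector space of linear maps B(K) -> B(H).
   In the order of C, [0 <= z] means that z is real and nonnegative, so the
   scalars lambda, mu and gamma below are real. *)
Notation inner_product K := {dot K for Num.conj}.

Section Operators.
Variables (C : numClosedFieldType) (K : vectType C) (dot : inner_product K).
Implicit Types X A B : 'End(K).

Definition positive_op A : Prop := forall v : K, 0 <= dot (A v) v.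

Definition op_le A B : Prop := positive_op (B - A).

Definition frame X (v : K) : K :=
  \sum_(i < \dim {:K}) dot v (X (vbasis {:K})`_i) *: (vbasis {:K})`_i.

Fact frame_is_linear X : linear (frame X).
Proof.
move=> a u v; rewrite /frame scaler_sumr -big_split /=; apply: eq_bigr => i _.
by rewrite linearDl linearZl_LR scalerDl scalerA.
Qed.
HB.instance Definition _ X :=
  GRing.isLinear.Build C K K *:%R (frame X) (frame_is_linear X).

(* With b the basis [vbasis {:K}], w = X^* v is the unique solution of
   <w, b_i> = <v, X b_i> for all i, that is of frame \1 w = frame X v.
   [adjointP] is the usual characterization. *)
Definition adjoint X : 'End(K) :=
  ((linfun (frame \1%VF))^-1 \o linfun (frame X))%VF.

Lemma frame_inj X Y u v : frame X u = frame Y v ->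
  forall w, dot u (X w) = dot v (Y w).
Proof.
move=> eqf w.
have eqb (i : 'I_(\dim {:K})) :
    dot u (X (vbasis {:K})`_i) = dot v (Y (vbasis {:K})`_i).
  have /freeP fr := basis_free (vbasisP {:K}).
  apply/eqP; rewrite -subr_eq0; apply/eqP.
  apply: (fr (fun i => dot u (X (vbasis {:K})`_i) -
                       dot v (Y (vbasis {:K})`_i))).
  under eq_bigr do rewrite scalerBl.
  by rewrite sumrB; apply/eqP; rewrite subr_eq0; apply/eqP.
rewrite (coord_vbasis (memvf w)) !linear_sum /=.
by apply: eq_bigr => i _; rewrite !linearZ /= eqb.
Qed.

Lemma adjointP X u v : dot (adjoint X u) v = dot u (X v).
Proof.
have inj : lker (linfun (frame \1%VF)) == 0%VS.
  apply/lker0P => x y; rewrite !lfunE /= => /frame_inj exy.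
  apply/eqP; rewrite -subr_eq0; apply/negPn/negP => /(neq0_dnorm_gt0 (s := dot)).
  have /eqP := exy (x - y); rewrite !id_lfunE -subr_eq0 -linearBl => /eqP e0.
  by rewrite lt_neqAle eq_sym e0 eqxx.
suff /frame_inj/(_ v) : frame \1%VF (adjoint X u) = frame X u.
  by rewrite id_lfunE.
have := lker0_lfunVK inj (linfun (frame X) u).
by rewrite /adjoint comp_lfunE !lfunE.
Qed.

(* The operator matrix [A_ij] acts on K^k by (A v)_i = \sum_j A_ij v_j, which
   identifies M_k(B(K)) with B(K^k); this is positivity of that operator. *)
Definition positive_block (k : nat) (A : 'M['End(K)]_k) : Prop :=
  forall v : 'I_k -> K, 0 <= \sum_i dot (\sum_j A i j (v j)) (v i).

End Operators.

Section Maps.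
Variables (C : numClosedFieldType) (K H : vectType C).
Variables (dotK : inner_product K) (dotH : inner_product H).
Implicit Types phi psi : 'Hom('End(K), 'End(H)).

Definition positive_map phi : Prop :=
  forall A, positive_op dotK A -> positive_op dotH (phi A).

Definition map_le psi phi : Prop := positive_map (phi - psi).

Definition extremal phi : Prop :=
  positive_map phi /\
  forall (lambda : C) psi, 0 <= lambda ->
    map_le 0 psi -> map_le psi (lambda *: phi) ->
    exists2 mu : C, 0 <= mu & psi = mu *: phi.

Definition locally_completely_positive phi : Prop :=
  positive_map phi /\
  exists2 gamma : C, 0 < gamma &
    forall X : 'End(K),
      let gphi := gamma *: phi in
      op_le dotH (gphi (adjoint dotK X) \o gphi X)%VF
                 (gphi (adjoint dotK X \o X)%VF).

Definition completely_positive phi : Prop :=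
  forall (k : nat) (A : 'M['End(K)]_k),
    positive_block dotK A -> positive_block dotH (map_mx phi A).

End Maps.

(* Main.v *)
Require Import Defs.
From HB Require Import structures.
From mathcomp Require Import all_boot all_order all_algebra.
From mathcomp Require Import sesquilinear complex reals.
From mathcomp Require Import ring.

(** Write |w><v| for the operator u |-> <u,v> w.  Apply the local complete
    positivity inequality to X = |x><y|: since X^*X = <x,x> |y><y| and
    X^* = |y><x|, it reads, up to a positive constant,

        phi(|y><x|) phi(|y><x|)^* <= c phi(|y><y|).

    For a fixed vector h of H put B y = phi(|y><x|) h, a linear map K -> H.
    As |h><h| <= <h,h> 1, the left hand side dominates a multiple of
    |B y><B y|, which is psi(|y><y|) for psi(A) = B A B^* ([column_bound]).
    A positive operator is a sum of operators |y><y|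
    ([positive_op_sum_rank_one]), so 0 <= psi <= lambda phi as maps, and
    extremality makes psi a multiple of phi.  If B is nonzero then so is
    psi, whence phi is itself a positive multiple of the completely positive
    map psi.  If B vanishes for all x and h, then phi kills every |y><x|,
    hence phi = 0 ([lfun_rank_one_eq0]).

    The passage from phi(|x><y|) to phi(|y><x|)^* is [positive_map_herm]; the
    operator B^* is built in [exists_adjoint] out of the vectors y_k with
    1 = sum_k |y_k><y_k|, which serve as an orthonormal basis would. *)

Set Implicit Arguments.
Unset Strict Implicit.
Unset Printing Implicit Defensive.

Import Order.TTheory GRing.Theory Num.Theory.
Local Open Scope ring_scope.

(** * Sesquilinear forms and rank one operators *)

(** Polarization: the diagonal at x + y gives s x y + s y x = 0, and at
    x + 'i y it gives s x y = s y x.  Applied to the difference of two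
    sesquilinear expressions, it reduces their equality to the diagonal. *)
Lemma sesqui_diag_eq0 (C : numClosedFieldType) (V : lmodType C)
    (s : V -> V -> C) :
    (forall a x y z, s (a *: x + y) z = a * s x z + s y z) ->
    (forall a x y z, s x (a *: y + z) = a^* * s x y + s x z) ->
    (forall x, s x x = 0) ->
  forall x y, s x y = 0.
Proof.
move=> sl sr s0 x y.
have alt u v : s u v + s v u = 0.
  have := s0 (1 *: u + v).
  by rewrite sl !sr !s0 conjC1 !mul1r addr0 add0r.
have s0r u : s u 0 = 0.
  by have := sr (-1) u u u; rewrite scaleN1r addNr s0 mulr0 addr0.
have s0l u : s 0 u = 0.
  by have := sl (-1) u u u; rewrite scaleN1r addNr s0 mulr0 addr0.
have := alt x ('i *: y).
rewrite -[X in s x X]addr0 -[X in s X x]addr0 sl sr s0r s0l !addr0 conjCi mulNr.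
rewrite addrC => /eqP; rewrite subr_eq0 => /eqP /(mulfI (neq0Ci C)) syx.
by have /eqP := alt x y; rewrite syx -mulr2n mulrn_eq0 => /eqP.
Qed.

Section RankOne.
Variables (C : numClosedFieldType) (V W : vectType C) (dot : inner_product V).

Definition rank_one_fun (w : W) (v : V) (u : V) : W := dot u v *: w.

Fact rank_one_fun_is_linear w v : linear (rank_one_fun w v).
Proof. by move=> a x y; rewrite /rank_one_fun linearPl scalerDl scalerA. Qed.
HB.instance Definition _ w v :=
  GRing.isLinear.Build C V W *:%R (rank_one_fun w v)
    (rank_one_fun_is_linear w v).

Definition rank_one w v : 'Hom(V, W) := linfun (rank_one_fun w v).

Lemma rank_oneE w v u : rank_one w v u = dot u v *: w.
Proof. by rewrite lfunE. Qed.

Lemma rank_oneDl a w w' v :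
  rank_one (a *: w + w') v = a *: rank_one w v + rank_one w' v.
Proof.
apply/lfunP => u; rewrite add_lfunE scale_lfunE !rank_oneE scalerDr !scalerA.
by rewrite mulrC.
Qed.

Lemma rank_oneDr a w v v' :
  rank_one w (a *: v + v') = a^* *: rank_one w v + rank_one w v'.
Proof.
apply/lfunP => u; rewrite add_lfunE scale_lfunE !rank_oneE linearPr /=.
by rewrite scalerDl scalerA.
Qed.

End RankOne.

Section InnerProduct.
Variables (C : numClosedFieldType) (V : vectType C) (dot : inner_product V).
Implicit Types A B : 'End(V).

Lemma dotC u v : dot u v = (dot v u)^*.
Proof. by rewrite hermC expr0 mul1r. Qed.

Lemma dot_injl u u' : (forall v, dot u v = dot u' v) -> u = u'.
Proof.
move=> e; apply/eqP; rewrite -subr_eq0 -(dnorm_eq0 dot).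
by rewrite linearBl /= e subrr.
Qed.

Lemma lfun_dotP A B : (forall u v, dot (A u) v = dot (B u) v) -> A = B.
Proof. by move=> e; apply/lfunP => u; apply: dot_injl. Qed.

(** Both sides are sesquilinear in u and v, and they agree on the diagonal
    because <A u, u> is real. *)
Lemma positive_op_herm A : positive_op dot A ->
  forall u v, dot (A u) v = dot u (A v).
Proof.
move=> A0 u v; apply/eqP; rewrite -subr_eq0; apply/eqP.
apply: (@sesqui_diag_eq0 _ _ (fun u v => dot (A u) v - dot u (A v)))
  => [a x y z|a x y z|x].
- by rewrite (linearP A) !linearPl /=; ring.
- by rewrite (linearP A) !linearPr /=; ring.
- by rewrite [X in _ - X]dotC (CrealP (ger0_real (A0 x))) subrr.
Qed.

(** The usual proof, for a form that may be degenerate: evaluate it at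
    p u + q v for a suitable choice of p and q. *)
Lemma positive_op_CauchySchwarz A : positive_op dot A ->
  forall u v, `|dot (A u) v| ^+ 2 <= dot (A u) u * dot (A v) v.
Proof.
move=> A0 u v; set s := dot (A u) v; set a := dot (A u) u; set b := dot (A v) v.
have a0 : 0 <= a by exact: A0.
have b0 : 0 <= b by exact: A0.
have q p q : 0 <= p * p^* * a + p * q^* * s + q * p^* * s^* + q * q^* * b.
  have := A0 (p *: u + q *: v).
  rewrite (linearD A) !(linearZ_LR A) linearDl /= !linearDr /=.
  rewrite !linearZl_LR /= !linearZr_LR /= -/s -/a -/b.
  rewrite [dot (A v) u]positive_op_herm // [dot v (A u)]dotC -/s.
  by congr (_ <= _); ring.
have [n nE] : exists n, n = s * s^* by exists (s * s^*).
have n0 : 0 <= n by rewrite nE mul_conjC_ge0.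
rewrite normCK -nE.
have [b_eq0|b_neq0] := eqVneq b 0; last first.
  have b_gt0 : 0 < b by rewrite lt_def b_neq0.
  (* b u - s v is b times the component of u orthogonal to v *)
  have := q b (- s); rewrite !rmorphN /= (CrealP (ger0_real b0)).
  have -> : b * b * a + b * - s^* * s + - s * b * s^* + - s * - s^* * b
     = b * (a * b - n) by rewrite nE; ring.
  by rewrite pmulr_rge0 // subr_ge0.
rewrite b_eq0 mulr0.
(* v is isotropic: the form at n u - (a + 1) s v is - n^2 (a + 2), so n = 0 *)
have := q n (- (a + 1) * s).
rewrite !(rmorphM, rmorphN, rmorphD, rmorph1) /= b_eq0 mulr0 addr0.
rewrite (CrealP (ger0_real n0)) (CrealP (ger0_real a0)).
have -> : n * n * a + n * (- (a + 1) * s^*) * s + - (a + 1) * s * n * s^*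
   = - (n ^+ 2 * (a + 2)) by rewrite nE; ring.
rewrite oppr_ge0 pmulr_lle0; last by rewrite ltr_wpDl.
move=> n2; suff /eqP -> : n == 0 by [].
by rewrite -sqrf_eq0 eq_le n2 exprn_ge0.
Qed.

End InnerProduct.

(** * Decomposition of positive operators *)

Section Decomposition.
Variables (C : numClosedFieldType) (V : vectType C) (dot : inner_product V).
Implicit Types A : 'End(V).

Lemma rank_one_quadE (x u : V) :
  dot (rank_one dot x x u) u = `|dot u x| ^+ 2.
Proof. by rewrite rank_oneE linearZl_LR /= [dot x u]dotC normCK. Qed.

Lemma positive_rank_one (x : V) : positive_op dot (rank_one dot x x).
Proof. by move=> u; rewrite rank_one_quadE exprn_ge0. Qed.

Lemma adjoint_rank_one (x y : V) :
  adjoint dot (rank_one dot x y) = rank_one dot y x.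
Proof.
apply: (lfun_dotP (dot := dot)) => u v; rewrite adjointP !rank_oneE.
by rewrite linearZr_LR /= linearZl_LR /= -dotC mulrC.
Qed.

Lemma comp_rank_one (x y : V) :
  (rank_one dot y x \o rank_one dot x y)%VF = dot x x *: rank_one dot y y.
Proof.
apply/lfunP => u; rewrite comp_lfunE scale_lfunE !rank_oneE linearZl_LR /=.
by rewrite !scalerA mulrC.
Qed.

(** Cholesky decomposition: if <A v, v> > 0, then subtracting
    |A v><A v| / <A v, v> keeps A positive, by Cauchy-Schwarz, and adds v to
    its kernel.  Hence the induction on the codimension of the kernel. *)
Lemma positive_op_sum_rank_one A : positive_op dot A ->
  exists ys : seq V, A = \sum_(y <- ys) rank_one dot y y.
Proof.
have [n] := ubnP (\dim {:V} - \dim (lker A)).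
elim: n => // n IHn in A * => ltn A0.
have [->|nzA] := eqVneq A 0; first by exists [::]; rewrite big_nil.
have [v nzAv] : exists v, A v != 0.
  have /memv_imgP[v _ Av] := memv_pick (limg A).
  exists v; rewrite -Av vpick0; apply: contraNneq nzA => A0'.
  apply/eqP/lfunP => u; apply/eqP; rewrite zero_lfunE -memv0 -A0'.
  exact: memv_img (memvf u).
(* <A v, v> = 0 would force <A v, A v> = 0 by Cauchy-Schwarz *)
have c_gt0 : 0 < dot (A v) v.
  rewrite lt_def A0 andbT; apply: contraNneq nzAv => Avv0.
  have := positive_op_CauchySchwarz A0 v (A v).
  rewrite Avv0 mul0r => le0; rewrite -(dnorm_eq0 dot) -normr_eq0 -sqrf_eq0.
  by rewrite eq_le le0 exprn_ge0.
set c := dot (A v) v in c_gt0.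
pose y := (sqrtC c)^-1 *: A v.
have rE u : rank_one dot y y u = (c^-1 * dot u (A v)) *: A v.
  rewrite rank_oneE /y linearZr_LR /= scalerA (CrealP _); last first.
    by rewrite ger0_real // invr_ge0 sqrtC_ge0 ltW.
  by rewrite mulrC mulrA -invfM -expr2 sqrtCK.
pose A' := A - rank_one dot y y.
have A'E u : A' u = A u - (c^-1 * dot u (A v)) *: A v.
  by rewrite /A' add_lfunE opp_lfunE rE.
have [||ys A'ys] := IHn A'; last first.
- by exists (y :: ys); rewrite big_cons -A'ys /A' addrC subrK.
- move=> u; rewrite A'E linearBl /= linearZl_LR /= -positive_op_herm //.
  rewrite subr_ge0 -mulrA mulrC ler_pdivrMr //.
  apply: le_trans (positive_op_CauchySchwarz A0 u v).
  by rewrite [dot (A v) u]positive_op_herm // [dot v _]dotC normCK.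
apply: leq_trans (ltnSE ltn); apply: ltn_sub2l; last first.
  rewrite (ltn_leqif (dimv_leqif_eq _)).
    apply: contraNneq nzAv => eqk; rewrite -memv_ker eqk memv_ker A'E.
    by rewrite -positive_op_herm // mulVf ?gt_eqF // scale1r subrr.
  apply/subvP => u; rewrite !memv_ker A'E => /eqP Au.
  by rewrite -positive_op_herm // Au linear0l mulr0 scale0r subrr.
rewrite (ltn_leqif (dimv_leqif_eq (subvf _))).
by apply: contraNneq nzAv => eqk; rewrite -memv_ker eqk memvf.
Qed.

(** The vectors ys form a Parseval frame, obtained by decomposing the identity;
    they need not be orthogonal, but expand vectors as an orthonormal basis
    does. *)
Lemma resolution_of_identity : exists ys : seq V,
  forall u, u = \sum_(y <- ys) dot u y *: y.
Proof.
have [|ys id_ys] := @positive_op_sum_rank_one \1%VF.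
  by move=> u; rewrite id_lfunE dnorm_ge0.
exists ys => u; rewrite -[LHS](id_lfunE u) id_ys sum_lfunE.
by apply: eq_bigr => y _; rewrite rank_oneE.
Qed.

End Decomposition.

Lemma exists_adjoint (C : numClosedFieldType) (K H : vectType C)
    (dotK : inner_product K) (dotH : inner_product H) (B : 'Hom(K, H)) :
  exists Bs : 'Hom(H, K), forall y k, dotH (B y) k = dotK y (Bs k).
Proof.
have [ys ysE] := resolution_of_identity dotK.
exists (\sum_(y <- ys) rank_one dotH y (B y)) => x k.
rewrite sum_lfunE [in LHS](ysE x) linear_sum linear_sumlz linear_sumr /=.
apply: eq_bigr => y _; rewrite rank_oneE linearZ /= linearZl_LR linearZr_LR /=.
by rewrite -dotC mulrC.
Qed.

(** * Linear maps between operator spaces *)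

Section MapOnRankOne.
Variables (C : numClosedFieldType) (K H : vectType C).
Variables (dotK : inner_product K) (dotH : inner_product H).
Implicit Type phi : 'Hom('End(K), 'End(H)).
Implicit Types (B : 'Hom(K, H)) (Bs : 'Hom(H, K)).

Lemma positive_map_from_rank_one phi :
    (forall y, positive_op dotH (phi (rank_one dotK y y))) ->
  positive_map dotK dotH phi.
Proof.
move=> pos A /positive_op_sum_rank_one[ys ->] k.
rewrite linear_sum sum_lfunE linear_sumlz /=.
by apply: sumr_ge0 => y _; apply: pos.
Qed.

(** Composing A with the resolution of the identity writes it as a sum of
    operators |A y><y|. *)
Lemma lfun_rank_one_eq0 phi :
  (forall x y, phi (rank_one dotK y x) = 0) -> phi = 0.
Proof.
move=> phi0; have [ys ysE] := resolution_of_identity dotK.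
apply/lfunP => A; rewrite zero_lfunE.
suff -> : A = \sum_(y <- ys) rank_one dotK (A y) y.
  by rewrite linear_sum big1 // => y _; apply: phi0.
apply/lfunP => u; rewrite [in LHS](ysE u) linear_sum sum_lfunE.
by apply: eq_bigr => y _; rewrite linearZ rank_oneE.
Qed.

(** A positive map commutes with adjoints on rank one operators.  The two sides
    are sesquilinear in x and y, and for x = y the claim is that the positive
    operator phi(|x><x|) is Hermitian. *)
Lemma positive_map_herm phi : positive_map dotK dotH phi ->
  forall x y u v, dotH (phi (rank_one dotK x y) u) v =
                  dotH u (phi (rank_one dotK y x) v).
Proof.
move=> pos x y u v; apply/eqP; rewrite -subr_eq0; apply/eqP.
apply: (@sesqui_diag_eq0 _ _ (fun x y => dotH (phi (rank_one dotK x y) u) v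
   - dotH u (phi (rank_one dotK y x) v))) => [a {}x {}y z|a {}x {}y z|{}x].
- rewrite rank_oneDl rank_oneDr !linearP !add_lfunE !scale_lfunE.
  by rewrite linearPl linearPr /= conjCK; ring.
- rewrite rank_oneDl rank_oneDr !linearP !add_lfunE !scale_lfunE.
  by rewrite linearPl linearPr /=; ring.
- by rewrite positive_op_herm ?subrr //; apply/pos/positive_rank_one.
Qed.

Definition conjugation_fun (B : 'Hom(K, H)) (Bs : 'Hom(H, K)) (A : 'End(K)) :
  'End(H) := (B \o A \o Bs)%VF.

Fact conjugation_fun_is_linear B Bs : linear (conjugation_fun B Bs).
Proof.
move=> a A1 A2; apply/lfunP => u.
rewrite add_lfunE scale_lfunE !comp_lfunE add_lfunE scale_lfunE.
by rewrite linearP.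
Qed.
HB.instance Definition _ B Bs :=
  GRing.isLinear.Build C 'End(K) 'End(H) *:%R (conjugation_fun B Bs)
    (conjugation_fun_is_linear B Bs).

Definition conjugation B Bs : 'Hom('End(K), 'End(H)) :=
  linfun (conjugation_fun B Bs).

Lemma conjugationE B Bs A : conjugation B Bs A = (B \o A \o Bs)%VF.
Proof. by rewrite lfunE. Qed.

Lemma conjugation_rank_one B Bs y k :
    (forall y k, dotH (B y) k = dotK y (Bs k)) ->
  dotH (conjugation B Bs (rank_one dotK y y) k) k = `|dotH (B y) k| ^+ 2.
Proof.
move=> adjB; rewrite conjugationE 2!comp_lfunE [LHS]adjB rank_one_quadE.
by rewrite dotC -adjB norm_conjC.
Qed.

(** The operator matrix of B A_ij B^* at the vectors v_i takes the value of
    the matrix A_ij at the vectors B^* v_i. *)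
Lemma conjugation_completely_positive mu B Bs : 0 <= mu ->
    (forall y k, dotH (B y) k = dotK y (Bs k)) ->
  completely_positive dotK dotH (mu *: conjugation B Bs).
Proof.
move=> mu0 adjB k A posA v.
suff -> :
    \sum_i dotH (\sum_j map_mx (mu *: conjugation B Bs) A i j (v j)) (v i) =
    mu * \sum_i dotK (\sum_j A i j (Bs (v j))) (Bs (v i)).
  by rewrite mulr_ge0 // posA.
rewrite mulr_sumr; apply: eq_bigr => i _.
rewrite -adjB -linearZl_LR /= linear_sum scaler_sumr; congr (dotH _ _).
apply: eq_bigr => j _.
by rewrite mxE !scale_lfunE conjugationE !comp_lfunE.
Qed.

(** The candidate for the Kraus operator of phi: if phi(A) = V A V^*, then this
    map is a multiple of V, namely <h, V x> V. *)
Definition column_fun phi (x : K) (h : H) (y : K) : H :=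
  phi (rank_one dotK y x) h.

Fact column_fun_is_linear phi x h : linear (column_fun phi x h).
Proof.
by move=> a y z; rewrite /column_fun rank_oneDl linearP add_lfunE scale_lfunE.
Qed.
HB.instance Definition _ phi x h :=
  GRing.isLinear.Build C K H *:%R (column_fun phi x h)
    (column_fun_is_linear phi x h).

Definition column phi x h : 'Hom(K, H) := linfun (column_fun phi x h).

Lemma columnE phi x h y : column phi x h y = phi (rank_one dotK y x) h.
Proof. by rewrite lfunE. Qed.

(** Local complete positivity at X = |x><y| gives
    gamma |S k|^2 <= <x,x> <phi(|y><y|) k, k> with S = phi(|x><y|), and the
    left hand side of the claim is |<h, S k>|^2. *)
Lemma column_bound phi gamma x h y k :
    positive_map dotK dotH phi -> 0 < gamma ->
    (forall X : 'End(K),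
       op_le dotH ((gamma *: phi) (adjoint dotK X) \o (gamma *: phi) X)%VF
                  ((gamma *: phi) (adjoint dotK X \o X)%VF)) ->
  `|dotH (column phi x h y) k| ^+ 2 <=
  gamma^-1 * dotK x x * dotH h h * dotH (phi (rank_one dotK y y) k) k.
Proof.
move=> pos g0 lcp.
have := lcp (rank_one dotK x y) k.
rewrite adjoint_rank_one comp_rank_one add_lfunE opp_lfunE comp_lfunE.
rewrite !scale_lfunE !linearZ /= scale_lfunE.
rewrite linearDl /= !linearZl_LR /= linearNl /= (positive_map_herm pos y x).
rewrite -mulrDr pmulr_rge0 // mulrN subr_ge0 => bound.
rewrite columnE positive_map_herm // (le_trans (CauchySchwarz dotH _ _)) //.
rewrite -!mulrA [dotK x x * _]mulrCA [gamma^-1 * _]mulrCA.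
by rewrite ler_wpM2l ?dnorm_ge0 // ler_pdivlMl.
Qed.

End MapOnRankOne.

(** * Extremal locally completely positive maps *)

Theorem locally_completely_positive_extremal (C : numClosedFieldType)
    (K H : vectType C) (dotK : inner_product K) (dotH : inner_product H)
    (phi : 'Hom('End(K), 'End(H))) :
  locally_completely_positive dotK dotH phi ->
  extremal dotK dotH phi ->
  completely_positive dotK dotH phi.
Proof.
move=> [pos [gamma gamma_gt0 lcp]] [_ ext].
have cp_of_nz x y h : phi (rank_one dotK y x) h != 0 ->
    completely_positive dotK dotH phi.
  rewrite -columnE; set B := column _ _ _ _ => nzB.
  have [Bs adjB] := exists_adjoint dotK dotH B.
  pose psi := conjugation B Bs.
  have l0 : 0 <= gamma^-1 * dotK x x * dotH h h.
    by rewrite !mulr_ge0 ?dnorm_ge0 // invr_ge0 ltW.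
  have [||mu mu0 psiE] := ext _ psi l0.
  - apply: positive_map_from_rank_one => z k.
    by rewrite subr0 conjugation_rank_one // exprn_ge0.
  - apply: positive_map_from_rank_one => z k.
    rewrite add_lfunE opp_lfunE add_lfunE opp_lfunE linearBl /= subr_ge0.
    rewrite conjugation_rank_one // !scale_lfunE linearZl_LR /=.
    exact: column_bound.
  have mu_neq0 : mu != 0.
    apply: contraNneq nzB => mu_eq0.
    have := conjugation_rank_one y (B y) adjB.
    rewrite -/psi psiE mu_eq0 scale0r !zero_lfunE linear0l.
    move/esym/eqP; rewrite sqrf_eq0 normr_eq0 dnorm_eq0; exact.
  have -> : phi = mu^-1 *: psi by rewrite psiE scalerA mulVf // scale1r.
  by apply: conjugation_completely_positive; rewrite ?invr_ge0.
(* Positivity of a block is a boolean, so one can argue by contradiction: if it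
   fails, no vector phi(|y><x|) h is nonzero, and phi = 0 *)
move=> k A posA v; apply/negPn/negP => neg.
case/negP: (neg).
rewrite (_ : phi = 0); last first.
  apply: (lfun_rank_one_eq0 (dotK := dotK)) => x y.
  apply/lfunP => h; rewrite zero_lfunE; apply/eqP/negPn/negP => nz.
  by case/negP: neg; apply: cp_of_nz nz _ _ posA v.
rewrite big1 // => i _; rewrite big1 ?linear0l // => j _.
by rewrite mxE !zero_lfunE.
Qed.

Local Open Scope complex_scope.

Theorem corollary5p9 (R : realType) (K H : vectType R[i])
    (dotK : inner_product K) (dotH : inner_product H)
    (phi : 'Hom('End(K), 'End(H))) :
  \dim {:H} = 2%N ->
  locally_completely_positive dotK dotH phi ->
  extremal dotK dotH phi ->
  completely_positive dotK dotH phi.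
Proof. by move=> _; exact: locally_completely_positive_extremal. Qed.
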